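(* Let $(M,F)$ be a conic pseudo-Finsler manifold of dimension $n$ with $F$ defined on the conic sub-bundle $\mathcal A$, let $\phi:\mathcal A\to\mathbb R$ be a smooth function positively homogeneous of degree $0$ in $y$, and let $\overline F=e^{\phi}F$. Then $\overline g_{ij}:=\tfrac12\dot\partial_i\dot\partial_j\overline F^2$ satisfies $$\overline g_{ij}=e^{2\phi}\Big[g_{ij}+2F^2\,(\dot\partial_i\phi)(\dot\partial_j\phi)+2F\big(\ell_j\,\dot\partial_i\phi+\ell_i\,\dot\partial_j\phi\big)+F^2\,\dot\partial_i\dot\partial_j\phi\Big],$$ where $\ell_i=\dot\partial_iF$.
   Context: $(x^i,y^i)$ are the coordinates on $TM$ induced by local coordinates on the smooth $n$-manifold $M$ and $\dot\partial_i=\partial/\partial y^i$. A conic sub-bundle is a non-empty open subset $\mathcal A\subset TM\setminus 0$ projecting onto $M$ and closed under multiplication by positive scalars. A conic pseudo-Finsler metric on $M$ is a smooth function $F:\mathcal A\to\mathbb R$, positively homogeneous of degree one in $y$, such that $g_{ij}=\tfrac12\dot\partial_i\dot\partial_jF^2$ is non-degenerate at each point of $\mathcal A$; $(M,F)$ is then called a conic pseudo-Finsler manifold. *)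

(* Defs.v *)
From mathcomp Require Import all_boot all_order all_algebra.
From mathcomp Require Import all_classical all_reals.
From mathcomp Require Import topology normedtype derive.

Set Implicit Arguments.
Unset Strict Implicit.
Unset Printing Implicit Defensive.

Import Order.TTheory GRing.Theory Num.Theory.
Import numFieldNormedType.Exports.

Local Open Scope classical_set_scope.
Local Open Scope ring_scope.

(* [Ck k U f]: f is of class C^k on the open set U.  In finite dimension the
   differential is C^k as a map into the linear maps iff all its evaluations,
   the directional derivatives, are C^k. *)
Fixpoint Ck (R : realType) (V W : normedModType R) (k : nat)
    (U : set V) (f : V -> W) : Prop :=
  match k with
  | 0 => {in U, continuous f}
  | k'.+1 => (forall x, U x -> differentiable f x) /\
             (forall v, Ck k' U (fun x => 'D_v f x))
  end.

Definition smooth_on (R : realType) (V W : normedModType R)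
    (U : set V) (f : V -> W) : Prop := forall k, Ck k U f.

(* A homeomorphism from the open set [cdom] of T onto an open subset of R^n;
   the values of [cmap] off [cdom], and of [cinv] off the image, are junk. *)
Record chart (R : realType) (n : nat) (T : topologicalType) := Chart {
  cdom : set T;
  cmap : T -> 'rV[R]_n;
  cinv : 'rV[R]_n -> T;
  cdom_open : open cdom;
  cimg_open : open (cmap @` cdom);
  cmapK : {in cdom, cancel cmap cinv};
  cmap_cts : {in cdom, continuous cmap};
  cinv_cts : {in cmap @` cdom, continuous cinv} }.

Definition cimg (R : realType) (n : nat) (T : topologicalType)
  (c : chart R n T) : set 'rV[R]_n := cmap c @` cdom c.

Definition transition (R : realType) (n : nat) (T : topologicalType)
  (c d : chart R n T) : 'rV[R]_n -> 'rV[R]_n := cmap d \o cinv c.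

Definition smooth_transition (R : realType) (n : nat) (T : topologicalType)
    (c d : chart R n T) : Prop :=
  smooth_on (cmap c @` (cdom c `&` cdom d)) (transition c d).

(* A smooth n-manifold, with its maximal atlas: the elements of [atlas] are all
   the local coordinate systems of the manifold. *)
Record manifold (R : realType) (n : nat) := Manifold {
  points :> topologicalType;
  atlas : set (chart R n points);
  points_hausdorff : hausdorff_space points;
  points_second_countable : @second_countable points;
  atlas_cover : forall p : points, exists2 c, atlas c & cdom c p;
  atlas_smooth : forall c d, atlas c -> atlas d -> smooth_transition c d;
  atlas_maximal : forall c,
    (forall d, atlas d -> smooth_transition c d /\ smooth_transition d c) ->
    atlas c }.

(* [chart_at c p]: c is a system of local coordinates of M around p. *)
Definition chart_at (R : realType) (n : nat) (M : manifold R n)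
  (c : chart R n M) (p : M) : Prop := atlas c /\ cdom c p.

(* A tangent vector is given by its base point and by its components in all the
   charts around it, related by the Jacobians of the transition maps.  The
   components in the irrelevant charts are set to 0, so that equality of
   tangent vectors is Leibniz equality. *)
Record tangent (R : realType) (n : nat) (M : manifold R n) := Tangent {
  tbase : M;
  tcomp : chart R n M -> 'rV[R]_n;
  tcomp_off : forall c, ~ chart_at c tbase -> tcomp c = 0;
  tcomp_change : forall c d, chart_at c tbase -> chart_at d tbase ->
    tcomp d = 'D_(tcomp c) (transition c d) (cmap c tbase) }.

Section TangentBundle.
Context {R : realType} {n : nat} {M : manifold R n}.
Implicit Types (c d e : chart R n M) (p : M) (v : tangent M).

Lemma cimgP c x : cimg c x -> cdom c (cinv c x) /\ cmap c (cinv c x) = x.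
Proof. by move=> [p cp <-]; rewrite cmapK ?inE. Qed.

Lemma differentiable_transition c d p : chart_at c p -> chart_at d p ->
  differentiable (transition c d) (cmap c p).
Proof.
move=> [ac cp] [ad dp]; have [+ _] := atlas_smooth ac ad 1%N.
by apply; exists p.
Qed.

Lemma near_cimg c x : cimg c x -> \forall y \near x, cimg c y.
Proof. by move=> cx; apply: open_nbhs_nbhs; split=> //; exact: cimg_open. Qed.

Lemma near_cdom c d x : cimg c x -> cdom d (cinv c x) ->
  \forall y \near x, cdom d (cinv c y).
Proof.
move=> cx dx; have := @cinv_cts _ _ _ c x (mem_set cx).
by apply; apply: open_nbhs_nbhs; split=> //; exact: cdom_open.
Qed.

Lemma transition_chain c d e p y :
  chart_at c p -> chart_at d p -> chart_at e p ->
  'D_y (transition c e) (cmap c p) =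
  'D_('D_y (transition c d) (cmap c p)) (transition d e) (cmap d p).
Proof.
move=> cp dp ep.
have pK : cinv c (cmap c p) = p by rewrite cmapK // inE; case: cp.
have dcd := differentiable_transition cp dp.
have dde := differentiable_transition dp ep.
have tcp : transition c d (cmap c p) = cmap d p by rewrite /transition /= pK.
have cx : cimg c (cmap c p) by exists p => //; case: cp.
have /near_eq_derive -> : \forall x \near cmap c p,
    transition c e x = (transition d e \o transition c d) x.
  have : \forall x \near cmap c p, cdom d (cinv c x).
    by apply: near_cdom => //; rewrite pK; case: dp.
  by apply: filterS => x dx; rewrite /transition /= (@cmapK _ _ _ d) ?inE.
rewrite deriveE; last by apply: differentiable_comp; rewrite ?tcp.
by rewrite diff_comp ?tcp //= -!deriveE.
Qed.

Definition tzero_section : set (tangent M) := [set v | forall c, tcomp v c = 0].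

Lemma tscale_off (t : R) v c : ~ chart_at c (tbase v) -> t *: tcomp v c = 0.
Proof. by move=> /tcomp_off ->; rewrite scaler0. Qed.

Lemma tscale_change (t : R) v c d :
  chart_at c (tbase v) -> chart_at d (tbase v) ->
  t *: tcomp v d =
  'D_(t *: tcomp v c) (transition c d) (cmap c (tbase v)).
Proof.
move=> cv dv; have df := differentiable_transition cv dv.
by rewrite deriveE // linearZ /= -deriveE // -tcomp_change.
Qed.

Definition tscale (t : R) v : tangent M :=
  Tangent (@tscale_off t v) (@tscale_change t v).

(* The coordinates (x, y) induced on TM by the chart c. *)
Definition tcoord c v : 'rV[R]_n * 'rV[R]_n := (cmap c (tbase v), tcomp v c).

(* The inverse of [tcoord c]: the tangent vector with coordinates z = (x, y)
   (a zero vector, as junk, when c is not in the atlas or x not in its image). *)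
Definition tvec_comp c (z : 'rV[R]_n * 'rV[R]_n) d : 'rV[R]_n :=
  if `[< (atlas c /\ cimg c z.1) /\ chart_at d (cinv c z.1) >]
  then 'D_(z.2) (transition c d) z.1 else 0.

Lemma tvec_off c z d : ~ chart_at d (cinv c z.1) -> tvec_comp c z d = 0.
Proof. by move=> nd; rewrite /tvec_comp; case: asboolP => // -[]. Qed.

Lemma tvec_change c z d e :
  chart_at d (cinv c z.1) -> chart_at e (cinv c z.1) ->
  tvec_comp c z e =
  'D_(tvec_comp c z d) (transition d e) (cmap d (cinv c z.1)).
Proof.
move=> dz ez; rewrite /tvec_comp.
case: asboolP => [[[ac cz] _]|ne]; case: asboolP => [[cz' _]|nd].
- have [cp xK] := cimgP cz.
  by have := transition_chain z.2 (conj ac cp) dz ez; rewrite xK.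
- by case: nd.
- by case: ne.
- by rewrite derive0.
Qed.

Definition tvec c z : tangent M := Tangent (@tvec_off c z) (@tvec_change c z).

Lemma tangent_eq v w : tbase v = tbase w -> tcomp v = tcomp w -> v = w.
Proof.
case: v w => [p y h1 h2] [q z k1 k2] /= pq yz; case: _ / pq k1 k2 => k1 k2.
by case: _ / yz k1 k2 => k1 k2; congr Tangent; exact: Prop_irrelevance.
Qed.

Lemma tcoordK c v : chart_at c (tbase v) -> tvec c (tcoord c v) = v.
Proof.
move=> cv; have pK : cinv c (cmap c (tbase v)) = tbase v.
  by rewrite cmapK // inE; case: cv.
apply: tangent_eq => //=; apply/funext => d; rewrite /tvec_comp /= pK.
case: asboolP => [[_ dv]|nd]; first by rewrite -tcomp_change.
rewrite tcomp_off // => dv; apply: nd; split=> //.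
by case: cv => ac cv; split=> //; exists (tbase v).
Qed.

Lemma tvecK c z : atlas c -> cimg c z.1 -> tcoord c (tvec c z) = z.
Proof.
case: z => x y /= ac cx; have [cp xK] := cimgP cx.
rewrite /tcoord /= xK /tvec_comp /=; congr pair.
case: asboolP => [_|[]] //.
have /near_eq_derive -> : \forall w \near x, transition c c w = id w.
  by apply: filterS (near_cimg cx) => w /cimgP[].
exact: derive_id.
Qed.

(* The coordinate representation of a subset of TM in the chart c. *)
Definition tlocal c (A : set (tangent M)) : set ('rV[R]_n * 'rV[R]_n) :=
  [set z | cimg c z.1 /\ A (tvec c z)].

Definition topen (A : set (tangent M)) : Prop :=
  forall c, atlas c -> open (tlocal c A).

Definition tsmooth_on (A : set (tangent M)) (f : tangent M -> R) : Prop :=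
  forall c, atlas c -> smooth_on (tlocal c A) (f \o tvec c).

Definition conic_subbundle (A : set (tangent M)) : Prop :=
  [/\ A !=set0, topen A, A `&` tzero_section = set0,
      @tbase R n M @` A = [set: M]
    & forall (t : R) v, 0 < t -> A v -> A (tscale t v)].

Definition pos_homogeneous (A : set (tangent M)) (k : nat)
    (f : tangent M -> R) : Prop :=
  forall (t : R) v, 0 < t -> A v -> f (tscale t v) = t ^+ k * f v.

(* The derivative with respect to y^i in the coordinates (x, y) induced by c. *)
Definition vpartial c (i : 'I_n) (f : tangent M -> R) : tangent M -> R :=
  fun v => 'D_((0, delta_mx 0 i) : 'rV[R]_n * 'rV[R]_n)
             (f \o tvec c) (tcoord c v).

Definition fundamental_tensor c (F : tangent M -> R) (i j : 'I_n) :
    tangent M -> R :=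
  fun v => 2^-1 * vpartial c i (vpartial c j (fun w => F w ^+ 2)) v.

(* Functions on A are represented by total functions on TM; since A is open,
   their values off A are irrelevant. *)
Definition conic_pseudo_Finsler (A : set (tangent M)) (F : tangent M -> R) :
    Prop :=
  [/\ conic_subbundle A, tsmooth_on A F, pos_homogeneous A 1 F
    & forall c v, chart_at c (tbase v) -> A v ->
        (\matrix_(i < n, j < n) fundamental_tensor c F i j v) \in unitmx].

End TangentBundle.

Arguments tangent {R n} M.

(* Main.v *)
(* In the coordinates (x, y) of a chart, [tvec] and [tcoord] are mutually inverse,
   so iterated [vpartial]s become, near the given vector, iterated directional
   derivatives on an open set. There, with f and p representing F and phi,
     D_b (e^p f)^2 = 2 e^(2p) (f D_b f + f^2 D_b p);
   differentiating this identity along a and comparing with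
     D_a D_b f^2 = 2 D_a (f D_b f)
   gives the formula. *)
Require Import Defs.
From mathcomp Require Import all_boot all_order all_algebra.
From mathcomp Require Import all_classical all_reals.
From mathcomp Require Import topology normedtype derive sequences exp.
From mathcomp Require Import ring.
Import Order.TTheory GRing.Theory Num.Theory.
Import numFieldNormedType.Exports.
Local Open Scope classical_set_scope.
Local Open Scope ring_scope.

Lemma is_derive_expR_comp {R : realType} {V : normedModType R} {p : V -> R}
    {z : V} (e : V) : differentiable p z ->
  is_derive z e (fun w => expR (p w)) (expR (p z) * 'D_e p z).
Proof.
move=> dp.
have dexp : differentiable (expR : R -> R) (p z).
  by apply/derivable1_diffP; exact: derivable_expR.
have dc : differentiable ((expR : R -> R) \o p) z by exact: differentiable_comp.
split; first exact: diff_derivable.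
rewrite deriveE // diff_comp //= diff1E // derive1E derive_val deriveE //.
by rewrite /GRing.scale /= mulrC.
Qed.

(** The exponential factor is kept as [expR (p z) ^+ 2], so that [ring] only meets the single atom
    [expR (p z)]. *)
Lemma is_derive_conformal_sqr {R : realType} {V : normedModType R}
    {f p : V -> R} {z : V} (b : V) : differentiable f z -> differentiable p z ->
  is_derive z b (fun w => (expR (p w) * f w) ^+ 2)
    (2 * expR (p z) ^+ 2 * (f z * 'D_b f z + f z ^+ 2 * 'D_b p z)).
Proof.
move=> df dp.
have ie := is_derive_expR_comp b dp.
have idf : is_derive z b f ('D_b f z).
  by apply: DeriveDef => //; exact: diff_derivable.
have im := is_deriveM ie idf.
apply: (is_derive_eq (is_deriveX 2 im)).
by rewrite !fctE /GRing.scale /=; ring.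
Qed.

(** Along a, the factor e^(2p) contributes 2 f D_b f D_a p + 2 f^2 D_a p D_b p, and f^2 D_b p
    contributes 2 f D_a f D_b p + f^2 D_a D_b p; what remains, D_a (f D_b f), is half of D_a D_b
    f^2. *)
Lemma derive2_conformal_sqr {R : realType} {V : normedModType R}
    {U : set V} {f p : V -> R} {z : V} (a b : V) : open U -> U z ->
  smooth_on U f -> smooth_on U p ->
  2^-1 * 'D_a (fun w => 'D_b (fun x => (expR (p x) * f x) ^+ 2) w) z =
  expR (2 * p z) *
    (2^-1 * 'D_a (fun w => 'D_b (fun x => f x ^+ 2) w) z
     + 2 * f z ^+ 2 * 'D_a p z * 'D_b p z
     + 2 * f z * ('D_b f z * 'D_a p z + 'D_a f z * 'D_b p z)
     + f z ^+ 2 * 'D_a (fun w => 'D_b p w) z).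
Proof.
move=> oU Uz sf sp.
have df w : U w -> differentiable f w by case: (sf 1%N) => + _; apply.
have dp w : U w -> differentiable p w by case: (sp 1%N) => + _; apply.
have isd (g : V -> R) : differentiable g z -> is_derive z a g ('D_a g z).
  by move=> dg; apply: DeriveDef => //; exact: diff_derivable.
have ddf : is_derive z a (fun w => 'D_b f w) ('D_a (fun w => 'D_b f w) z).
  by apply: isd; case: (sf 2%N) => _ /(_ b)[+ _]; apply.
have ddp : is_derive z a (fun w => 'D_b p w) ('D_a (fun w => 'D_b p w) z).
  by apply: isd; case: (sp 2%N) => _ /(_ b)[+ _]; apply.
have idf := isd _ (df _ Uz); have idp := isd _ (dp _ Uz).
have ie := is_derive_expR_comp a (dp _ Uz).
have nU : \forall w \near z, U w by apply: open_nbhs_nbhs.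
(* The first-order formula holds on all of [U], a neighbourhood of z, and may therefore be
   differentiated once more. *)
have -> : 'D_a (fun w => 'D_b (fun x => (expR (p x) * f x) ^+ 2) w) z =
  'D_a (fun w => 2 * expR (p w) ^+ 2 *
          (f w * 'D_b f w + f w ^+ 2 * 'D_b p w)) z.
  apply: near_eq_derive; apply: filterS nU => w Uw.
  by have [_ ->] := is_derive_conformal_sqr b (df _ Uw) (dp _ Uw).
have -> : 'D_a (fun w => 'D_b (fun x => f x ^+ 2) w) z =
  'D_a (fun w => 2 * (f w * 'D_b f w)) z.
  apply: near_eq_derive; apply: filterS nU => w Uw.
  have iw : is_derive w b f ('D_b f w).
    by apply: DeriveDef => //; apply: diff_derivable; exact: df.
  have [_ ->] := is_deriveX 2 iw.
  by rewrite /GRing.scale /=; ring.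
have i1 := is_deriveM idf ddf.
have i2 := is_deriveM (is_deriveX 2 idf) ddp.
have i3 := is_deriveX 2 ie.
have i4 := is_deriveZ (2 : R) (is_deriveM i3 (is_deriveD i1 i2)).
have i5 := is_deriveZ (2 : R) i1.
(* Operations on values are recast as operations on functions, the form in which [i4] and [i5] are
   stated. *)
have -> : (fun w => 2 * expR (p w) ^+ 2 *
          (f w * 'D_b f w + f w ^+ 2 * 'D_b p w)) =
   2 *: ((fun w => expR (p w)) ^+ 2 *
     (f * (fun w => 'D_b f w) + f ^+ 2 * (fun w => 'D_b p w))).
  by apply/funext => w; rewrite -mulrA.
have -> : (fun w => 2 * (f w * 'D_b f w)) = 2 *: (f * (fun w => 'D_b f w)).
  by [].
have [_ ->] := i4; have [_ ->] := i5.
(* After this, both sides are polynomials in the same atoms, up to the constant [2^-1]. *)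
have -> : expR (2 * p z) = expR (p z) ^+ 2.
  by rewrite mulr_natl mulr2n expRD.
rewrite !fctE /GRing.scale /=.
by field.
Qed.

Lemma vpartial_tvec {R : realType} {n : nat} {M : manifold R n}
    (c : chart R n M) (j : 'I_n) (G : tangent M -> R) z :
  atlas c -> cimg c z.1 ->
  vpartial c j G (tvec c z) = 'D_((0, delta_mx 0 j)) (G \o tvec c) z.
Proof. by move=> ac cz; rewrite /vpartial tvecK. Qed.

Theorem proposition2p5 (R : realType) (n : nat) (M : manifold R n)
    (A : set (tangent M)) (F phi : tangent M -> R)
    (hF : conic_pseudo_Finsler A F)
    (phi_smooth : tsmooth_on A phi)
    (phi_hom : pos_homogeneous A 0 phi)
    (c : chart R n M) (v : tangent M)
    (hc : chart_at c (tbase v)) (hv : A v) (i j : 'I_n) :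
  let Fbar := fun w : tangent M => expR (phi w) * F w in
  let l := fun k : 'I_n => vpartial c k F in
  fundamental_tensor c Fbar i j v =
    expR (2 * phi v) *
    (fundamental_tensor c F i j v
     + 2 * F v ^+ 2 * vpartial c i phi v * vpartial c j phi v
     + 2 * F v * (l j v * vpartial c i phi v + l i v * vpartial c j phi v)
     + F v ^+ 2 * vpartial c i (vpartial c j phi) v).
Proof.
move=> Fbar l.
case: hF => -[_ oA _ _ _] sF _ _.
have [ac cv] := hc.
have vK := tcoordK hc.
have Uv : tlocal c A (tcoord c v).
  by split; [exists (tbase v) | rewrite vK].
(* The inner [vpartial] is a directional derivative only over the image of the chart; the outer one
   sees only the germ at [tcoord c v], and the open set [tlocal c A] lies over that image. *)
have vpartial2 G : vpartial c i (vpartial c j G) v =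
    'D_((0, delta_mx 0 i))
      (fun w => 'D_((0, delta_mx 0 j)) (G \o tvec c) w) (tcoord c v).
  apply: near_eq_derive; apply: filterS (open_nbhs_nbhs (conj (oA c ac) Uv)).
  by move=> z [cz _] /=; rewrite vpartial_tvec.
rewrite /fundamental_tensor !vpartial2 /l /vpartial.
(* Here f and p are [F \o tvec c] and [phi \o tvec c]; [vK] turns their values at [tcoord c v] into
   those of [F] and [phi] at [v]. *)
have := derive2_conformal_sqr (0, delta_mx 0 i) (0, delta_mx 0 j) (oA c ac) Uv
  (sF c ac) (phi_smooth c ac).
by rewrite /= vK.
Qed.
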